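(* There exists a universal constant $C>0$ such that, for all positive integers $n,N,m$, any $\epsilon\in(0,1)$ and any $\theta\in\mathcal{S}^{n-1}$, we have $$\mathbb{P}\Big(\Big|\frac1N\log\|X\theta\| - \frac1N\sup_{\theta'\in\mathcal{S}^{n-1}}\log\|X\theta'\|\Big|\;\ge\;\frac{1}{2N}\log\Big(\frac{n}{\epsilon^2}\Big)\Big)\;\le\;(C\epsilon)^{1/2}.$$
   Context: For integers $n, N, m$, let $X_{ij}$ ($1\le i\le m$, $1\le j\le N$) be i.i.d. random $n\times n$ real matrices, each with i.i.d. $\mathcal{N}(0, n^{-1})$ entries, and set $$X := \frac{1}{\sqrt m}\sum_{i=1}^m X_i, \qquad X_i := X_{iN}X_{i(N-1)}\cdots X_{i1}.$$ $\mathcal{S}^{n-1}\subset\mathbb{R}^n$ is the Euclidean unit sphere and $\|\cdot\|$ is the Euclidean norm. *)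

(* Defs.v *)
From HB Require Import structures.
From mathcomp Require Import all_boot all_order all_algebra.
From mathcomp Require Import all_classical all_reals all_analysis.

Set Implicit Arguments.
Unset Strict Implicit.
Unset Printing Implicit Defensive.

Import Order.TTheory GRing.Theory Num.Theory.
Local Open Scope classical_set_scope.
Local Open Scope ring_scope.

Section Probability.
Context (d : measure_display) (T : measurableType d) (R : realType)
  (P : probability T R).

Definition mutually_independent (I : finType) (Y : I -> {RV P >-> R}) : Prop :=
  forall (J : {set I}) (A : I -> set R),
    (forall i, i \in J -> measurable (A i)) ->
    P (\bigcap_(i in [set` J]) Y i @^-1` A i) =
    (\prod_(i in J) P (Y i @^-1` A i))%E.

(* [v] is the variance, whereas [normal_prob] takes the standard deviation. *)
Definition has_normal_law (mean v : R) (Y : {RV P >-> R}) : Prop :=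
  forall A : set R, measurable A ->
    distribution P Y A = normal_prob mean (Num.sqrt v) A.

(* [X i j k l] is the entry [(k, l)] of the random matrix with indices [i, j].
   I.i.d. matrices with i.i.d. entries: all the entries are jointly i.i.d. *)
Definition iid_gaussian_matrices (n N m : nat)
    (X : 'I_m -> 'I_N -> 'I_n -> 'I_n -> {RV P >-> R}) : Prop :=
  mutually_independent
    (fun p : 'I_m * 'I_N * 'I_n * 'I_n => X p.1.1.1 p.1.1.2 p.1.2 p.2) /\
  (forall i j k l, has_normal_law 0 n%:R^-1 (X i j k l)).

Definition random_mx (n : nat) (Y : 'I_n -> 'I_n -> {RV P >-> R}) (w : T) :
    'M[R]_n :=
  \matrix_(k, l) Y k l w.

(* [rev_ord] puts the factor with the largest index [j] leftmost. *)
Definition chain_mx (n N : nat) (Y : 'I_N -> 'I_n -> 'I_n -> {RV P >-> R})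
    (w : T) : 'M[R]_n :=
  \prod_(j < N) random_mx (Y (rev_ord j)) w.

Definition sum_mx (n N m : nat)
    (X : 'I_m -> 'I_N -> 'I_n -> 'I_n -> {RV P >-> R}) (w : T) : 'M[R]_n :=
  (Num.sqrt m%:R)^-1 *: \sum_(i < m) chain_mx (X i) w.

End Probability.

(* The library norm on matrices is the sup norm. *)
Definition enorm (R : realType) (n : nat) (v : 'cV[R]_n) : R :=
  Num.sqrt (\sum_(k < n) v k 0 ^+ 2).

Definition unit_sphere (R : realType) (n : nat) : set 'cV[R]_n :=
  [set v | enorm v = 1].

(* Extended-real valued, so that [log 0 = -oo]. *)
Definition log_enorm (R : realType) (n : nat) (v : 'cV[R]_n) : \bar R :=
  lne (enorm v)%:E.

(* Main.v *)
Require Import Defs.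
From HB Require Import structures.
From mathcomp Require Import all_boot all_order all_algebra.
From mathcomp Require Import all_classical all_reals all_analysis.
From mathcomp Require Import measurable_realfun.
From mathcomp Require Import zify ring lra.

Set Implicit Arguments.
Unset Strict Implicit.
Unset Printing Implicit Defensive.

Import Order.TTheory GRing.Theory Num.Theory.
Import numFieldNormedType.Exports.
Local Open Scope classical_set_scope.
Local Open Scope ring_scope.

(* Write X = m^(-1/2) * sum_i A_i G_i, where G_i is the rightmost factor of the
   i-th chain and A_i the product of the remaining ones, so that the G_i are
   independent of the A_i. Let b_k be 1/m times the sum over i of the squared
   norms of the k-th rows of the A_i. Given the A_i, the k-th entry of X v is,
   for every unit vector v, a centred Gaussian of variance b_k / n. Let B be the
   sum of the b_k, which is almost surely nonzero, and w_k = b_k / B. If the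
   event holds then, the operator norm being at most the Frobenius norm |X|_F,
   |X theta|^2 <= eps^2 |X|_F^2 / n, and therefore
     1 <= sum_k w_k 1[(X theta)_k^2 <= eps b_k / n] + eps |X|_F^2 / B.
   Given the A_i, each indicator has expectation at most sqrt(eps), whatever the
   correlations between the rows, and |X|_F^2 / B has expectation at most a
   constant. By Markov's inequality the event has probability at most
   9 sqrt(eps). *)

(** * Measurability of square roots and indicators *)

Lemma measurable_sqrt (R : realType) : measurable_fun [set: R] (@Num.sqrt R).
Proof. apply: continuous_measurable_fun; exact: sqrt_continuous. Qed.

Lemma measurable_bool_natr d (T : measurableType d) (R : realType)
    (g : T -> bool) :
  measurable_fun setT g -> measurable_fun setT (fun z => (g z)%:R : R).
Proof.
move=> mg; rewrite (_ : (fun _ => _) = \1_(g @^-1` [set true])).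
  by apply: measurable_indic; rewrite -[X in measurable X]setTI; exact: mg.
apply/funext => z; rewrite indicE; congr ((_ : bool)%:R).
by apply/idP/idP; rewrite inE.
Qed.

(** * Normal distribution *)

Section normal_law.
Context {R : realType}.
Notation mu := (@lebesgue_measure R).

(** The density and the Radon-Nikodym derivative have equal integrals over all measurable sets,
    hence agree almost everywhere. *)
Lemma ge0_integral_normal_prob (m s : R) (f : R -> \bar R) :
  measurable_fun setT f -> (forall x, 0 <= f x)%E ->
  (\int[normal_prob m s]_x f x = \int[mu]_x (f x * (normal_pdf m s x)%:E))%E.
Proof.
move=> mf f0; have dom := normal_prob_dominates m s.
rewrite -(Radon_Nikodym_SigmaFinite.change_of_variables dom)//.
have irn := Radon_Nikodym_SigmaFinite.f_integrable dom.
have mpdf : measurable_fun setT (EFin \o normal_pdf m s).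
  by apply/measurable_EFinP; exact: measurable_normal_pdf.
apply: ae_eq_integral => //.
- by apply: emeasurable_funM => //; exact: measurable_int irn.
- exact: emeasurable_funM.
- apply: ae_eqe_mul2l; apply: integral_ae_eq => //= E _ mE.
  by rewrite -(Radon_Nikodym_SigmaFinite.f_integral dom).
Qed.

(** By uniqueness of Lebesgue measure it suffices to treat half-open intervals; a negative [b] swaps
    the endpoints and the one that is included. *)
Lemma pushforward_affine_lebesgue (m b : R) (A : set R) : b != 0 ->
  measurable A ->
  (mu ((fun x => m + b * x)%R @^-1` A) = `|b|^-1%:E * mu A)%E.
Proof.
move=> b0 mA; have b1 : 0 <= `|b| by [].
pose phi (x : measurableTypeR R) : measurableTypeR R := m + b * x.
suff -> : mu A = (`|b|%:E * mu (phi @^-1` A))%E.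
  by rewrite muleA -EFinM mulVf ?normr_eq0// mul1e.
apply: (@lebesgue_measure_unique R (mscale (NngNum b1)
  (pushforward mu phi))) => //=.
  apply: measurable_funD => //; exact: measurable_funM.
move=> ? _ [[u v] _ <-].
rewrite /mscale/= /pushforward lebesgue_measure_itv/=.
have [bp|bn] := ltP 0 b.
  have -> : phi @^-1` `]u, v] = `](u - m) / b, (v - m) / b]%classic.
    apply/seteqP; split => x /=; rewrite !in_itv/= /phi ltr_pdivrMr//
      ler_pdivlMr//;
    by rewrite ltrBlDl lerBrDl mulrC.
  rewrite lebesgue_measure_itv/= !lte_fin ltr_pM2r ?invr_gt0// ltrD2r.
  case: ifPn => _; last by rewrite mule0.
  rewrite -EFinB -!EFinM; congr EFin; rewrite gtr0_norm//; field.
  by rewrite gt_eqF.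
have {b0 bn}bn : b < 0 by rewrite lt_neqAle b0.
have -> : phi @^-1` `]u, v] = `[(v - m) / b, (u - m) / b[%classic.
  apply/seteqP; split => x /=; rewrite !in_itv/= /phi ltr_ndivlMr//
    ler_ndivrMr//;
  by rewrite ltrBlDl lerBrDl mulrC andbC.
rewrite lebesgue_measure_itv/= !lte_fin ltr_nM2r ?invr_lt0// ltrD2r.
case: ifPn => _; last by rewrite mule0.
rewrite -EFinB -!EFinM; congr EFin; rewrite ltr0_norm//; field.
by rewrite lt_eqF.
Qed.

(** A change of variables in which the Jacobian [|b|] cancels against the peak. The deviation
    [b * s] may be negative: the density depends on its square only. *)
Lemma normal_prob_affine (m b s : R) (A : set R) : b != 0 -> s != 0 ->
  measurable A ->
  normal_prob 0 s ((fun x => m + b * x) @^-1` A) = normal_prob m (b * s) A.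
Proof.
move=> b0 s0 mA.
pose phi (x : measurableTypeR R) : measurableTypeR R := m + b * x.
have mphi : measurable_fun setT phi.
  by apply: measurable_funD => //; exact: measurable_funM.
have b1 : 0 <= `|b|^-1 by rewrite invr_ge0.
pose g (y : R) : \bar R := (normal_pdf m (b * s) y)%:E.
have mg : measurable_fun setT g.
  by apply/measurable_EFinP; exact: measurable_normal_pdf.
have g0 y : (0 <= g y)%E by rewrite lee_fin normal_pdf_ge0.
pose h y := (`|b|%:E * g y)%E.
have mh : measurable_fun setT h by exact: emeasurable_funM.
have h0 y : (0 <= h y)%E by rewrite mule_ge0.
rewrite /normal_prob.
transitivity (\int[mu]_(x in phi @^-1` A)
    (h \o phi) x)%E.
  apply: eq_integral => x _; rewrite /= /h -EFinM; congr EFin.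
  rewrite !normal_pdfE ?mulf_neq0// mulrA; congr (_ * _).
    rewrite /normal_peak exprMn -!mulrnAr -[in RHS]mulrA.
    rewrite [in RHS](sqrtrM _ (sqr_ge0 b)) sqrtr_sqr invfM mulrA.
    by rewrite divff ?normr_eq0// mul1r.
  congr expR; rewrite /phi; field.
  by rewrite s0 b0.
rewrite -ge0_integral_pushforward//; last exact: measurable_funTS.
rewrite (eq_measure_integral (mscale (NngNum b1) mu)); last first.
  by move=> B mB _; exact: pushforward_affine_lebesgue.
rewrite ge0_integral_mscale//; last exact: measurable_funTS.
rewrite ge0_integralZl//; last exact: measurable_funTS.
by rewrite muleA -EFinM mulVf ?normr_eq0// mul1e.
Qed.

Lemma ge0_integral_normal_prob_affine (m b s : R) (f : R -> \bar R) :
  b != 0 -> s != 0 -> measurable_fun setT f -> (forall x, 0 <= f x)%E ->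
  (\int[normal_prob 0%R s]_x f (m + b * x)%R =
   \int[normal_prob m (b * s)%R]_x f x)%E.
Proof.
move=> b0 s0 mf f0.
pose phi (x : measurableTypeR R) : measurableTypeR R := m + b * x.
have mphi : measurable_fun setT phi.
  by apply: measurable_funD => //; exact: measurable_funM.
transitivity (\int[pushforward (normal_prob 0%R s) phi]_x f x)%E.
  by rewrite ge0_integral_pushforward.
by apply: eq_measure_integral => A mA _; exact: normal_prob_affine.
Qed.

Lemma normal_peakE (s : R) : normal_peak s = `|s|^-1 * (Num.sqrt (pi *+ 2))^-1.
Proof. by rewrite /normal_peak -mulrnAr sqrtrM ?sqr_ge0// sqrtr_sqr invfM. Qed.

(* Both sides are the joint density of [(y, a * y + b * x)] for independent
   centred normal [x] and [y], disintegrated along either coordinate. *)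
Lemma normal_pdf_bayes (a b r s y z : R) : b != 0 -> s != 0 -> 0 < r ->
  r ^+ 2 = a ^+ 2 + b ^+ 2 ->
  normal_pdf (a * y) (b * s) z * normal_pdf 0 s y =
  normal_pdf 0 (r * s) z * normal_pdf (a * z / r ^+ 2) (b * s / r) y.
Proof.
move=> b0 s0 r0 rE; have r1 : r != 0 by rewrite gt_eqF.
rewrite !normal_pdfE ?mulf_neq0 ?invr_neq0// ![_ * normal_fun _ _ _ * _]mulrACA.
congr (_ * _).
  rewrite !normal_peakE !normrM normfV (gtr0_norm r0); field.
  by rewrite r1 !normr_eq0 s0 b0 gt_eqF// sqrtr_gt0 pmulrn_lgt0// pi_gt0.
rewrite /normal_fun -!expRD; congr expR.
rewrite (exprMn 2 r) (exprMn 2 _ r^-1) exprVn rE; field.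
by rewrite s0 b0 -rE expf_neq0.
Qed.

(** Integrating over [x] first produces the density [normal_pdf (a * y) (b * s)]. After
    [normal_pdf_bayes] the variable [y] integrates to 1, which leaves the law of deviation
    [Num.sqrt (a ^+ 2 + b ^+ 2) * s]. *)
Lemma ge0_integral_normal_probD (a b s : R) (f : R -> \bar R) :
  0 <= a -> s != 0 -> measurable_fun setT f -> (forall x, 0 <= f x)%E ->
  (\int[normal_prob 0%R s]_x \int[normal_prob 0%R s]_y f (b * x + a * y)%R =
   \int[normal_prob 0%R s]_x f (Num.sqrt (a ^+ 2 + b ^+ 2) * x)%R)%E.
Proof.
move=> a0 s0 mf f0.
(* The degenerate case has no inner density; here the sign of [a] gives [Num.sqrt (a ^+ 2) = a]. *)
have [->|b0] := eqVneq b 0.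
  rewrite expr0n/= addr0 sqrtr_sqr ger0_norm//.
  under eq_integral do under eq_integral do rewrite mul0r add0r.
  by rewrite integral_cst//= probability_setT mule1.
set r := Num.sqrt _.
have r0 : 0 < r by rewrite sqrtr_gt0 ltr_wpDl ?sqr_ge0// exprn_even_gt0.
have rE : r ^+ 2 = a ^+ 2 + b ^+ 2 by rewrite sqr_sqrtr// addr_ge0 ?sqr_ge0.
have r1 : r != 0 by rewrite gt_eqF.
rewrite (fubini_tonelli (fun p : measurableTypeR R * measurableTypeR R =>
  f (b * p.1 + a * p.2)))//=; last first.
  apply: measurableT_comp => //; apply: measurable_funD => //;
  exact: measurable_funM.
under eq_integral => y _.
  under eq_integral do rewrite addrC.
  rewrite ge0_integral_normal_prob_affine// ge0_integral_normal_prob//.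
  over.
have mpdf : measurable_fun setT
  (fun p : measurableTypeR R * measurableTypeR R =>
   f p.2 * (normal_pdf (a * p.1) (b * s) p.2)%:E)%E.
  apply: emeasurable_funM; first exact: measurableT_comp.
  apply/measurable_EFinP.
  under eq_fun do rewrite normal_pdfE ?mulf_neq0//.
  apply: measurable_funM => //; apply: measurableT_comp => //.
  apply: measurable_funM => //; apply: measurableT_comp => //.
  apply: measurable_funX; apply: measurable_funB => //; exact: measurable_funM.
rewrite ge0_integral_normal_prob//; last 2 first.
- apply: (measurable_fun_fubini_tonelli_F _ mpdf) => p.
  by rewrite mule_ge0// lee_fin normal_pdf_ge0.
- by move=> y; apply: integral_ge0 => z _;
    rewrite mule_ge0// lee_fin normal_pdf_ge0.
transitivity (\int[mu]_z (f z * (normal_pdf 0 (r * s) z)%:E))%E; last first.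
  rewrite -(ge0_integral_normal_prob 0 (r * s) mf f0).
  rewrite -(ge0_integral_normal_prob_affine 0 r1 s0 mf f0).
  by apply: eq_integral => z _; rewrite add0r.
pose g (p : measurableTypeR R * measurableTypeR R) :=
  (f p.2 * (normal_pdf (a * p.1) (b * s) p.2)%:E * (normal_pdf 0 s p.1)%:E)%E.
transitivity (\int[mu]_y \int[mu]_z g (y, z))%E.
  apply: eq_integral => y _; rewrite -ge0_integralZr//.
  - apply: emeasurable_funM => //; apply/measurable_EFinP.
    exact: measurable_normal_pdf.
  - by move=> z _; rewrite mule_ge0// lee_fin normal_pdf_ge0.
  - by rewrite lee_fin normal_pdf_ge0.
rewrite (fubini_tonelli g); last 2 first.
- apply: emeasurable_funM => //; apply/measurable_EFinP.
  exact: measurableT_comp (measurable_normal_pdf _ _) _.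
- by move=> p; rewrite !mule_ge0// lee_fin normal_pdf_ge0.
apply: eq_integral => z _.
under eq_integral => y _.
  rewrite /g/= -muleA -EFinM (normal_pdf_bayes _ _ b0 s0 r0 rE) EFinM muleA.
  over.
rewrite ge0_integralZl//.
- by rewrite integral_normal_pdf mule1.
- by apply/measurable_EFinP; exact: measurable_normal_pdf.
- by move=> y _; rewrite lee_fin normal_pdf_ge0.
- by rewrite mule_ge0// lee_fin normal_pdf_ge0.
Qed.

(** The density is at most its peak and the interval has length [2 * t * |s|], so the mass is at
    most [2 * t / Num.sqrt (2 * pi)], which is at most [t] because [pi >= 2]. *)
Lemma normal_prob_small_ball (t s : R) : 0 <= t -> s != 0 ->
  (normal_prob 0 s [set x : R | (x ^+ 2 <= t ^+ 2 * s ^+ 2)%R] <= t%:E)%E.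
Proof.
move=> t0 s0; pose u := t * `|s|.
have u0 : 0 <= u by rewrite mulr_ge0.
have -> : [set x : R | x ^+ 2 <= t ^+ 2 * s ^+ 2] = `[- u, u]%classic.
  apply/seteqP; split => x /=; rewrite in_itv/= -ler_norml;
  by rewrite -[s ^+ 2]real_normK ?num_real// -exprMn -/u -[x ^+ 2]real_normK
    ?num_real// ler_pXn2r// nnegrE.
apply: (@le_trans _ _ (\int[mu]_(x in `[(- u)%R, u]) (normal_peak s)%:E))%E.
  apply: ge0_le_integral => //=.
  - by move=> x _; rewrite lee_fin normal_pdf_ge0.
  - by apply: measurable_funTS; apply/measurable_EFinP;
      exact: measurable_normal_pdf.
  - by move=> x _; rewrite lee_fin normal_pdf_ub.
rewrite integral_cst//= lebesgue_measure_itv/= lte_fin; case: ifPn => _;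
  last first.
  by rewrite mule0 lee_fin.
rewrite -EFinB -EFinM lee_fin normal_peakE opprK /u.
have -> : `|s|^-1 * (Num.sqrt (pi *+ 2))^-1 * (t * `|s| + t * `|s|) =
    t * (2 * (Num.sqrt (pi *+ 2))^-1).
  field; rewrite normr_eq0 s0/= gt_eqF// sqrtr_gt0 pmulrn_lgt0// pi_gt0.
  by [].
have p0 : 0 < Num.sqrt (pi *+ 2) :> R by rewrite sqrtr_gt0 pmulrn_lgt0// pi_gt0.
rewrite ler_piMr// ler_pdivrMr// mul1r -[leLHS]ger0_norm// -[leLHS]sqrtr_sqr.
by rewrite ler_wsqrtr// expr2 -(mulr_natr pi) ler_pM2r// pi_ge2.
Qed.

(* Pointwise, [x ^+ 2 * pdf 0 s x <= 8 * s ^+ 2 * pdf 0 (2 * s) x]. *)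
Lemma normal_prob_second_moment (s : R) : s != 0 ->
  (\int[normal_prob 0%R s]_x (x ^+ 2)%:E <= (8 * s ^+ 2)%:E)%E.
Proof.
move=> s0; rewrite ge0_integral_normal_prob//; last 2 first.
- by apply/measurable_EFinP; exact: measurable_funX.
- by move=> x; rewrite lee_fin sqr_ge0.
rewrite -[leRHS]mule1 -[X in (_ * X)%E](integral_normal_pdf 0 (2 * s)).
rewrite -ge0_integralZl//; last 3 first.
- by apply/measurable_EFinP; exact: measurable_normal_pdf.
- by move=> x _; rewrite lee_fin normal_pdf_ge0.
- by rewrite lee_fin mulr_ge0// sqr_ge0.
apply: ge0_le_integral => //=.
- by move=> x _; rewrite mule_ge0// lee_fin ?sqr_ge0// normal_pdf_ge0.
- apply: emeasurable_funM; apply/measurable_EFinP; first exact: measurable_funX.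
  exact: measurable_normal_pdf.
- apply: emeasurable_funM; apply/measurable_EFinP => //.
  exact: measurable_normal_pdf.
move=> x _; rewrite lee_fin !normal_pdfE ?mulf_neq0//.
rewrite !normal_peakE normrM (ger0_norm (ler0n R 2)) invfM /normal_fun !subr0.
set c := `|s|^-1; set k := (Num.sqrt (pi *+ 2))^-1.
have c0 : 0 <= c by rewrite invr_ge0.
have k0 : 0 <= k by rewrite invr_ge0 sqrtr_ge0.
(* In terms of [v] the two exponents are [- 4 * v] and [- v], so the bound becomes
   [v * expR (- 3 * v) <= 1 / 2], which follows from [expR u >= 1 + u]. *)
pose v := x ^+ 2 / (s ^+ 2 *+ 8).
have v0 : 0 <= v by rewrite divr_ge0 ?sqr_ge0// mulrn_wge0// sqr_ge0.
have -> : - x ^+ 2 / (s ^+ 2 *+ 2) = - v + - (v *+ 3) by rewrite /v; field.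
have -> : - x ^+ 2 / ((2 * s) ^+ 2 *+ 2) = - v by rewrite /v; field.
have -> : x ^+ 2 = v * (8 * s ^+ 2) by rewrite /v; field.
rewrite expRD.
have : v * expR (- (v *+ 3)) <= 2^-1.
  rewrite expRN ler_pdivrMr ?expR_gt0//.
  have := expR_ge1Dx (v *+ 3); lra.
set w := expR (- (v *+ 3)) => vw.
have -> : v * (8 * s ^+ 2) * (c * k * (expR (- v) * w)) =
  (v * w) * (8 * s ^+ 2 * c * k * expR (- v)) by ring.
have -> : 8 * s ^+ 2 * (2^-1 * c * k * expR (- v)) =
  2^-1 * (8 * s ^+ 2 * c * k * expR (- v)) by field.
apply: ler_wpM2r => //.
by rewrite mulr_ge0 ?expR_ge0// mulr_ge0// mulr_ge0// mulr_ge0 ?sqr_ge0.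
Qed.

End normal_law.

(** * Independence and Gaussian linear forms *)

Section adapted.
Context d (T : measurableType d) (R : realType) (P : probability T R).
Context (I : finType) (X : I -> {RV P >-> R}).
Implicit Types J K : {set I}.

(** A pi-system on which independence can be read off; uniqueness of measures extends it to the
    generated sigma-algebra. *)
Definition cylinder J : set (set T) :=
  [set S | exists2 A : I -> set R, (forall i, measurable (A i)) &
    S = \bigcap_(i in [set` J]) X i @^-1` A i].

(* A copy of [T] carrying the sigma-algebra generated by the [X i], [i \in J];
   [to_sub] and [sub_to_sub] are the identity maps between these spaces. *)
Local Notation sub_space J := (g_sigma_algebraType (cylinder J)).

(** Expresses that [f] depends only on the [X i] with [i] in [J]. Freezing adapted functions takes
    the place of conditional expectation. *)
Definition adapted J d' (U : measurableType d') (f : T -> U) :=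
  @measurable_fun _ _ (sub_space J) U setT f.

Definition to_sub J : T -> sub_space J := id.

Definition sub_to_sub K J : sub_space K -> sub_space J := id.

Lemma cylinderT J : cylinder J setT.
Proof.
exists (fun=> setT) => //; apply/seteqP; split => w //.
Qed.

Lemma cylinder_setI J : setI_closed (cylinder J).
Proof.
move=> _ _ [A mA ->] [B mB ->]; exists (fun i => A i `&` B i).
  by move=> i; exact: measurableI.
by rewrite -bigcapI.
Qed.

Lemma cylinder_measurable J : cylinder J `<=` @measurable _ T.
Proof.
move=> _ [A mA ->]; apply: fin_bigcap_measurable => //.
by move=> i _; exact: measurable_funPTI.
Qed.

Lemma cylinderS J K : J \subset K -> cylinder J `<=` cylinder K.
Proof.
move=> JK _ [A mA ->].
exists (fun i => if i \in J then A i else setT).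
  by move=> i; case: ifP.
apply/seteqP; split => w /= h i /= iJ.
  by case: ifPn => // iJ'; exact: h.
by have := h i; rewrite /= (fintype.subsetP JK) ?iJ//; exact.
Qed.

Lemma measurable_sub_to_sub K J : J \subset K ->
  measurable_fun setT (@sub_to_sub K J).
Proof.
move=> JK; apply: (@measurability _ _ _ _ setT (@sub_to_sub K J)
  (cylinder J) erefl).
move=> _ [S cS <-]; rewrite setTI; apply: sub_sigma_algebra.
exact: cylinderS cS.
Qed.

Lemma measurable_to_sub J : measurable_fun setT (@to_sub J).
Proof.
apply: (@measurability _ _ _ _ setT (@to_sub J) (cylinder J) erefl).
by move=> _ [S cS <-]; rewrite setTI; exact: cylinder_measurable cS.
Qed.

Lemma adaptedS J K d' (U : measurableType d') (f : T -> U) :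
  J \subset K -> adapted J f -> adapted K f.
Proof.
by move=> JK mf; apply: (measurableT_comp mf); exact: measurable_sub_to_sub.
Qed.

Lemma adapted_measurable J d' (U : measurableType d') (f : T -> U) :
  adapted J f -> measurable_fun setT f.
Proof.
by move=> mf; apply: (measurableT_comp mf); exact: measurable_to_sub.
Qed.

Lemma adapted_self J i : i \in J -> adapted J (X i : T -> R).
Proof.
move=> iJ _ A mA; rewrite setTI; apply: sub_sigma_algebra.
exists (fun k => if k == i then A else setT).
  by move=> k; case: ifP.
apply/seteqP; split => w /=.
  by move=> h k /= kJ; case: eqP => // ->.
by move=> /(_ i); rewrite /= eqxx; exact.
Qed.

Hypothesis indX : mutually_independent X.

(** The intersection is a cylinder over [J] with [p] added, and its product formula splits off the
    factor at [p]. *)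
Lemma independent_cylinder J p S A : p \notin J -> cylinder J S ->
  measurable A -> P (S `&` X p @^-1` A) = (P S * P (X p @^-1` A))%E.
Proof.
move=> pJ [B mB ->] mA.
pose C i := if i == p then A else B i.
have mC i : measurable (C i) by rewrite /C; case: ifP.
have CB i : i \in J -> C i = B i.
  by rewrite /C; case: eqP => // -> /(negP pJ).
have -> : \bigcap_(i in [set` J]) X i @^-1` B i =
    \bigcap_(i in [set` J]) X i @^-1` C i.
  by apply: eq_bigcapr => i /= iJ; rewrite CB.
have -> : X p @^-1` A = X p @^-1` C p by rewrite /C eqxx.
have -> : (\bigcap_(i in [set` J]) X i @^-1` C i) `&` X p @^-1` C p =
    \bigcap_(i in [set` (p |: J)%SET]) X i @^-1` C i.
  apply/seteqP; split => w /=.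
    by move=> [h1 h2] i; rewrite /= in_setU1 => /orP[/eqP ->//|]; exact: h1.
  by move=> h; split => [i /= iJ|]; apply: h;
    rewrite /= in_setU1 ?iJ ?orbT ?eqxx.
by rewrite !indX// big_setU1//= muleC.
Qed.

(** For fixed [A], both sides are finite measures in [S] that agree on the pi-system of
    cylinders. *)
Lemma independent_sub_space J p (S : set (sub_space J)) A :
  p \notin J -> measurable S ->
  measurable A -> P (S `&` X p @^-1` A) = (P S * P (X p @^-1` A))%E.
Proof.
move=> pJ mS mA.
have mXA : measurable (X p @^-1` A) by exact: measurable_funPTI.
have k0 : 0 <= fine (P (X p @^-1` A)) by rewrite fine_ge0.
pose m2 := mscale (NngNum k0) P.
rewrite muleC -[P (_ @^-1` _)]fineK ?fin_num_measure//.
apply: (g_sigma_algebra_measure_unique (cylinder J) _ (fun=> setT) _ _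
  (mrestr P mXA) m2 (@cylinder_setI J)) mS => //.
- exact: cylinder_measurable.
- by move=> _; exact: cylinderT.
- by rewrite bigcup_const.
- move=> B cB; rewrite /= /mrestr /m2/= /mscale/=.
  rewrite (independent_cylinder pJ cB)//.
  by rewrite muleC fineK// fin_num_measure.
- by move=> _; rewrite /= /mrestr setTI (le_lt_trans (probability_le1 _ _))//
    ltry.
Qed.

End adapted.
Arguments to_sub {d T R P I} X J _.
Arguments sub_to_sub {d T R P I} X K J _.

(** * Integrating out independent Gaussian variables *)

Section gaussian_family.
Context d (T : measurableType d) (R : realType) (P : probability T R).
Context (I : finType) (X : I -> {RV P >-> R}) (s : R).
Hypothesis s0 : s != 0.
Hypothesis indX : mutually_independent X.
Hypothesis lawX : forall i A, measurable A ->
  distribution P (X i) A = normal_prob 0 s A.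
Implicit Types J K : {set I}.
Local Notation sub_space J := (g_sigma_algebraType (cylinder X J)).
Local Notation R' := (measurableTypeR R).
Local Notation nu := (normal_prob 0%R s).

(** The pair of [to_sub X J] and [X p] has a product law, so Tonelli's theorem integrates the new
    variable with the old ones frozen. *)
Lemma integral_independent J p (F : sub_space J * R' -> \bar R) :
  p \notin J -> measurable_fun setT F -> (forall z, 0 <= F z)%E ->
  (\int[P]_w F (to_sub X J w, X p w) =
   \int[P]_w \int[nu]_x F (to_sub X J w, x))%E.
Proof.
move=> pJ mF F0.
have mU := @measurable_to_sub _ _ _ _ _ X J.
pose U : {RV P >-> sub_space J} :=
  HB.pack (to_sub X J) (isMeasurableFun.Build _ _ _ _ (to_sub X J) mU).
have mZ : measurable_fun setT (fun w => (to_sub X J w, X p w : R')).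
  by apply: measurable_fun_pair => //; exact: (measurable_funP (X p)).
pose Z : {RV P >-> (sub_space J * R')%type} :=
  HB.pack (fun w => (to_sub X J w, X p w : R'))
    (isMeasurableFun.Build _ _ _ _ _ mZ).
transitivity (\int[distribution P Z]_z F z)%E.
  by rewrite ge0_integral_distribution.
have E A : measurable A -> distribution P Z A = (distribution P U \x nu)%E A.
  move=> mA; apply/esym.
 apply: product_measure_unique => // B C mB mC.
  transitivity (P B * distribution P (X p) C)%E; last by rewrite lawX.
  exact: (independent_sub_space indX pJ mB mC).
transitivity (\int[distribution P U \x nu]_z F z)%E.
  have := @eq_measure_integral _ _ _ setT (distribution P U \x nu)%E
    (distribution P Z) F (fun A mA _ => E A mA).
  exact.
rewrite fubini_tonelli1// ge0_integral_distribution//.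
- exact: measurable_fun_fubini_tonelli_F.
- by move=> u; exact: integral_ge0.
Qed.

(** Given the variables in [J], the linear form is a centred Gaussian whose variance is [s ^+ 2]
    times the sum of the squared coefficients. By induction on [l], the head term is split off and
    then merged with the Gaussian that replaces the tail. *)
Lemma integral_linear_gaussian J (K : eqType) (h : K -> I) (l : seq K)
    (c : K -> T -> R) (F : sub_space J * R' -> \bar R) :
  uniq [seq h k | k <- l] -> (forall k, h k \notin J) ->
  (forall k, adapted X J (c k)) ->
  measurable_fun setT F -> (forall z, 0 <= F z)%E ->
  (\int[P]_w F (to_sub X J w, \sum_(k <- l) c k w * X (h k) w)%R =
   \int[P]_w \int[nu]_x
     F (to_sub X J w, Num.sqrt (\sum_(k <- l) c k w ^+ 2) * x)%R)%E.
Proof.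
move=> + hJ mc; elim: l F => [|p l IHl] F /=.
  move=> _ mF F0; apply: eq_integral => w _.
  under [in RHS]eq_integral do rewrite big_nil sqrtr0 mul0r.
  by rewrite big_nil integral_cst//= probability_setT mule1.
move=> /andP[pl ul] mF F0.
(* All indices on which the coefficients and the tail sum depend; the head index lies outside, so
   its variable can be integrated out. *)
pose K' := (J :|: [set i in [seq h k | k <- l]])%SET.
have JK : J \subset K' by exact: finset.subsetUl.
have mY : adapted X K' (fun w => \sum_(k <- l) c k w * X (h k) w).
  under eq_fun do rewrite big_seq big_mkcond.
  apply: measurable_sum => k; have [kl|//] := boolP (k \in l).
  apply: measurable_funM; first exact: adaptedS (mc k).
  by apply: adapted_self; rewrite finset.in_setU inE map_f ?orbT.
pose Y (w : sub_space K') := \sum_(k <- l) c k w * X (h k) w.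
pose V (w : T) := \sum_(k <- l) c k w ^+ 2.
have V0 w : 0 <= V w by apply: sumr_ge0 => k _; exact: sqr_ge0.
have mV : adapted X J V by apply: measurable_sum => k; apply: measurable_funX;
  exact: mc.
pose G (z : sub_space K' * R') :=
  F (sub_to_sub X K' J z.1, c p z.1 * z.2 + Y z.1).
have mG : measurable_fun setT G.
  apply: (measurableT_comp mF); apply: measurable_fun_pair.
    apply: (@measurableT_comp _ _ _ _ _ _ (sub_to_sub X K' J)) => //.
    exact: measurable_sub_to_sub.
  apply: measurable_funD; last by apply: (@measurableT_comp _ _ _ _ _ _ Y).
  apply: measurable_funM => //.
  apply: (@measurableT_comp _ _ _ _ _ _ (c p : sub_space K' -> R)) => //.
  exact: adaptedS (mc p).
transitivity (\int[P]_w G (to_sub X K' w, X (h p) w))%E.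
  by apply: eq_integral => w _; rewrite big_cons.
have G0 z : (0 <= G z)%E by exact: F0.
have pK : h p \notin K' by rewrite finset.in_setU inE negb_or hJ.
rewrite (integral_independent pK mG G0).
rewrite (fubini_tonelli (fun z : T * R' => G (to_sub X K' z.1, z.2)))//;
  last first.
  apply: (measurableT_comp mG); apply: measurable_fun_pair => //.
  apply: (measurableT_comp (measurable_to_sub (X := X) (J := K'))) => //.
pose H (z : (T * R') * R') :=
  F (to_sub X J z.1.1, c p z.1.1 * z.1.2 + Num.sqrt (V z.1.1) * z.2).
have mH : measurable_fun setT H.
  apply: (measurableT_comp mF); apply: measurable_fun_pair.
    apply: (@measurableT_comp _ _ _ _ _ _ (to_sub X J)).
      exact: measurable_to_sub.
    by apply: (@measurableT_comp _ _ _ _ _ _ fst).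
  apply: measurable_funD; apply: measurable_funM => //.
  - apply: (@measurableT_comp _ _ _ _ _ _ (c p));
      first exact: adapted_measurable (mc p).
    by apply: (@measurableT_comp _ _ _ _ _ _ fst).
  - by apply: (@measurableT_comp _ _ _ _ _ _ snd).
  - apply: measurableT_comp; first exact: measurable_sqrt.
    apply: (@measurableT_comp _ _ _ _ _ _ V);
      first exact: adapted_measurable mV.
    by apply: (@measurableT_comp _ _ _ _ _ _ fst).
transitivity (\int[nu]_x \int[P]_w \int[nu]_y H ((w, x), y))%E.
  apply: eq_integral => x _.
  (* With the head variable frozen at [x], the induction hypothesis applies to [F] shifted by
     [c p * x]. *)
  pose Fx (z : sub_space J * R') := F (z.1, c p z.1 * x + z.2).
  have mFx : measurable_fun setT Fx.
    apply: (measurableT_comp mF); apply: measurable_fun_pair => //.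
    apply: measurable_funD => //; apply: measurable_funM => //.
    exact: (measurableT_comp (mc p)).
  exact: (IHl Fx ul mFx (fun z => F0 _)).
rewrite -(fubini_tonelli (fun z => \int[nu]_y H (z, y))%E); last 2 first.
- exact: (measurable_fun_fubini_tonelli_F H mH (fun z => F0 _)).
- by move=> z; apply: integral_ge0 => y _; exact: F0.
apply: eq_integral => w _.
have mFw : measurable_fun setT (fun y : R => F (to_sub X J w, y)).
  by apply: (measurableT_comp mF).
apply: etrans (@ge0_integral_normal_probD _ (Num.sqrt (V w))
  (c p w) s _ _ s0 mFw (fun=> F0 _)) _ => //.
by apply: eq_integral => y _; rewrite big_cons sqr_sqrtr// addrC.
Qed.
End gaussian_family.

(** * Second moments and small balls of linear forms with random coefficients *)

Section gaussian_linear_form.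
Context d (T : measurableType d) (R : realType) (P : probability T R).
Context (I : finType) (X : I -> {RV P >-> R}) (s : R).
Hypothesis s0 : s != 0.
Hypothesis indX : mutually_independent X.
Hypothesis lawX : forall i A, measurable A ->
  distribution P (X i) A = normal_prob 0 s A.
Context (J : {set I}) (K : finType) (h : K -> I) (c : K -> T -> R) (W : T -> R).
Hypothesis h_inj : injective h.
Hypothesis hJ : forall k, h k \notin J.
Hypothesis adc : forall k, adapted X J (c k).
Hypothesis adW : adapted X J W.
Hypothesis W0 : forall w, 0 <= W w.
Local Notation sub_space := (g_sigma_algebraType (cylinder X J)).
Local Notation R' := (measurableTypeR R).
Local Notation nu := (normal_prob 0%R s).
Local Notation V := (fun w => \sum_k c k w ^+ 2).
Local Notation L := (fun w => \sum_k c k w * X (h k) w).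

Let uniq_h : uniq [seq h k | k <- index_enum K].
Proof. by rewrite map_inj_uniq// index_enum_uniq. Qed.

Let adV : adapted X J V.
Proof. by apply: measurable_sum => k; apply: measurable_funX; exact: adc. Qed.

Let V0 w : 0 <= V w. Proof. by apply: sumr_ge0 => k _; exact: sqr_ge0. Qed.

Let measurable_fst_sub (f : T -> R) : adapted X J f ->
  measurable_fun setT (fun z : sub_space * R' => f z.1).
Proof.
by move=> mf; apply: (@measurableT_comp _ _ _ _ _ _ (f : sub_space -> R)).
Qed.

Let measurable_inner (F : sub_space * R' -> \bar R) :
  measurable_fun setT F -> (forall z, 0 <= F z)%E ->
  measurable_fun setT
    (fun w => \int[nu]_x F (to_sub X J w, Num.sqrt (V w) * x)%R)%E.
Proof.
move=> mF F0; pose H (z : T * R') := F (to_sub X J z.1, Num.sqrt (V z.1) * z.2).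
apply: (measurable_fun_fubini_tonelli_F H _ (fun z => F0 _)).
apply: (measurableT_comp mF); apply: measurable_fun_pair.
  apply: (@measurableT_comp _ _ _ _ _ _ (to_sub X J)) => //.
  exact: measurable_to_sub.
apply: measurable_funM => //.
apply: measurableT_comp; first exact: measurable_sqrt.
apply: (@measurableT_comp _ _ _ _ _ _ V) => //.
exact: adapted_measurable adV.
Qed.

(** With the variables in [J] frozen, [W] is constant and [L] is [Num.sqrt V] times a normal
    variable of deviation [s]. *)
Lemma linear_form_second_moment :
  (\int[P]_w (W w * L w ^+ 2)%:E <= \int[P]_w (8 * s ^+ 2 * (W w * V w))%:E)%E.
Proof.
pose F (z : sub_space * R') := (W z.1 * z.2 ^+ 2)%:E.
have mF : measurable_fun setT F.
  apply/measurable_EFinP; apply: measurable_funM;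
    first exact: measurable_fst_sub.
  by apply: measurable_funX.
have F0 z : (0 <= F z)%E by rewrite lee_fin mulr_ge0// sqr_ge0.
rewrite [leLHS](integral_linear_gaussian s0 indX lawX uniq_h hJ adc mF F0).
apply: ge0_le_integral => //.
- by move=> w _; apply: integral_ge0 => x _; exact: F0.
- exact: measurable_inner.
- apply/measurable_EFinP; apply: measurable_funM => //.
  apply: measurable_funM; first exact: adapted_measurable adW.
  exact: adapted_measurable adV.
move=> w _.
rewrite (eq_integral (fun x : R' => (W w * V w)%:E * (x ^+ 2)%:E)%E);
  last first.
  by move=> x _; rewrite /F/= exprMn sqr_sqrtr ?V0// mulrA EFinM.
rewrite ge0_integralZl//.
- rewrite [leRHS](_ : _ = ((W w * V w)%:E * (8 * s ^+ 2)%:E)%E); last first.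
    by rewrite -EFinM mulrC.
  apply: lee_wpmul2l; first by rewrite lee_fin mulr_ge0// V0.
  exact: normal_prob_second_moment.
- by apply/measurable_EFinP; exact: measurable_funX.
- by move=> x _; rewrite lee_fin sqr_ge0.
- by rewrite lee_fin mulr_ge0// V0.
Qed.

(** With the variables in [J] frozen, a positive [V] cancels from the event and leaves a small ball
    for one normal variable. Where [V] vanishes the event is certain, so [W] is required to vanish
    there. *)
Lemma linear_form_small_ball (t : R) :
  0 <= t -> (forall w, V w = 0 -> W w = 0) ->
  (\int[P]_w (W w * (L w ^+ 2 <= t ^+ 2 * s ^+ 2 * V w)%R%:R)%:E <=
   \int[P]_w (t * W w)%:E)%E.
Proof.
move=> t0 VW.
pose F (z : sub_space * R') :=
  (W z.1 * (z.2 ^+ 2 <= t ^+ 2 * s ^+ 2 * V z.1)%R%:R)%:E.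
have mF : measurable_fun setT F.
  apply/measurable_EFinP; apply: measurable_funM;
    first exact: measurable_fst_sub.
  apply: measurable_bool_natr; apply: measurable_fun_ler.
    by apply: measurable_funX.
  by apply: measurable_funM => //; exact: (measurable_fst_sub adV).
have F0 z : (0 <= F z)%E by rewrite lee_fin mulr_ge0.
rewrite [leLHS](integral_linear_gaussian s0 indX lawX uniq_h hJ adc mF F0).
apply: ge0_le_integral => //.
- by move=> w _; apply: integral_ge0 => x _; exact: F0.
- exact: measurable_inner.
- by apply/measurable_EFinP; apply: measurable_funM => //;
    exact: adapted_measurable adW.
move=> w _; have [Vw|Vw] := eqVneq (V w) 0.
  rewrite /F/= (VW _ Vw) mulr0.
  by under eq_integral do rewrite mul0r; rewrite integral0.
pose B := [set x : R | x ^+ 2 <= t ^+ 2 * s ^+ 2].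
have mB : measurable B.
  rewrite -[X in measurable X]setTI.
  exact: (measurable_fun_ler (f := fun x : R => x ^+ 2) (g := cst _)).
rewrite (eq_integral (fun x : R' => (W w)%:E * (\1_B x)%:E)%E); last first.
  move=> x _; rewrite /F/= exprMn sqr_sqrtr ?V0// [_ * V w]mulrC ler_pM2l.
    by rewrite EFinM indicE mem_setE.
  by rewrite lt_neqAle eq_sym Vw V0.
rewrite ge0_integralZl//.
- rewrite mulrC EFinM integral_indic// setIT.
  apply: lee_wpmul2l; first by rewrite lee_fin.
  exact: normal_prob_small_ball.
- by apply/measurable_EFinP; exact: measurable_indic.
- by rewrite lee_fin W0.
Qed.

End gaussian_linear_form.

(** * Almost sure nonvanishing of linear forms *)

Section gaussian_linear_form_neq0.
Context d (T : measurableType d) (R : realType) (P : probability T R).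
Context (I : finType) (X : I -> {RV P >-> R}) (s : R).
Hypothesis s0 : s != 0.
Hypothesis indX : mutually_independent X.
Hypothesis lawX : forall i A, measurable A ->
  distribution P (X i) A = normal_prob 0 s A.

(** This is the small-ball bound at radius [t = 0], weighted by the indicator [W] of a nonzero
    variance. *)
Lemma linear_form_neq0 (J : {set I}) (K : finType) (h : K -> I)
    (c : K -> T -> R) : injective h -> (forall k, h k \notin J) ->
  (forall k, adapted X J (c k)) ->
  P.-negligible [set w | \sum_k c k w ^+ 2 != 0 /\
                         \sum_k c k w * X (h k) w = 0].
Proof.
move=> h_inj hJ adc.
have mV : measurable_fun setT (fun w => \sum_k c k w ^+ 2).
  apply: measurable_sum => k; apply: measurable_funX.
  exact: adapted_measurable (adc k).
have mL : measurable_fun setT (fun w => \sum_k c k w * X (h k) w).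
  apply: measurable_sum => k; apply: measurable_funM => //.
  exact: adapted_measurable (adc k).
pose W w : R := (~~ (\sum_k c k w ^+ 2 <= 0))%:R.
have adW : adapted X J W.
  apply: measurable_bool_natr; apply: measurable_neg.
  apply: measurable_fun_ler => //; apply: measurable_sum => k.
  by apply: measurable_funX; exact: adc.
have W0 w : 0 <= W w by [].
have VW w : \sum_k c k w ^+ 2 = 0 -> W w = 0 by rewrite /W => ->; rewrite lexx.
have := linear_form_small_ball s0 indX lawX h_inj hJ adc adW W0 (lexx 0) VW.
under [leRHS]eq_integral do rewrite mul0r.
rewrite integral0; set A := [set w | _]; set f := (fun w => _) => f0.
have fE : f = EFin \o \1_A.
  apply/funext => w; rewrite /f /W/= expr0n/= !mul0r indicE -natrM mulnb.
  congr ((_ : bool)%:R%:E); rewrite -ltNge lt_neqAle sumr_ge0; last first.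
    by move=> k _; exact: sqr_ge0.
  rewrite andbT eq_sym le_eqVlt ltNge sqr_ge0 orbF sqrf_eq0.
  apply/idP/idP => [/andP[V0 /eqP L0]|]; first by rewrite inE.
  by rewrite inE => -[-> ->]; rewrite eqxx.
have mA : measurable A.
  apply: measurableI; rewrite -[X in measurable X]setTI.
    apply: (measurable_neg (f := fun w => \sum_k c k w ^+ 2 == 0)) => //.
    by apply: measurable_fun_eqr.
  exact: (mL _ _ (measurable_set1 0)).
apply/negligibleP => //; apply/eqP; rewrite eq_le measure_ge0 andbT.
by move: f0; rewrite fE integral_indic// setIT.
Qed.

End gaussian_linear_form_neq0.

(** * Euclidean norm and operator norm *)

Section euclidean_norm.
Context {R : realType}.

Definition sqnorm n (v : 'cV[R]_n) : R := \sum_k v k 0 ^+ 2.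

(** The square of the Frobenius norm, matching [sqnorm]. *)
Definition frobenius n (M : 'M[R]_n) : R := \sum_k \sum_l M k l ^+ 2.

Lemma sqnorm_ge0 n (v : 'cV[R]_n) : 0 <= sqnorm v.
Proof. by apply: sumr_ge0 => k _; exact: sqr_ge0. Qed.

Lemma frobenius_ge0 n (M : 'M[R]_n) : 0 <= frobenius M.
Proof. by apply: sumr_ge0 => k _; apply: sumr_ge0 => l _; exact: sqr_ge0. Qed.

Lemma sqnormZ n a (v : 'cV[R]_n) : sqnorm (a *: v) = a ^+ 2 * sqnorm v.
Proof. by rewrite mulr_sumr; apply: eq_bigr => k _; rewrite mxE exprMn. Qed.

Lemma enormE n (v : 'cV[R]_n) : enorm v = Num.sqrt (sqnorm v).
Proof. by []. Qed.

Lemma unit_sphereE n (v : 'cV[R]_n) : unit_sphere v <-> sqnorm v = 1.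
Proof.
rewrite /unit_sphere/= enormE; split=> [h|->]; last exact: sqrtr1.
by rewrite -[LHS]sqr_sqrtr ?sqnorm_ge0// h expr1n.
Qed.

(** Lagrange's identity writes the difference of the two sides as half a sum of squares. *)
Lemma cauchy_schwarz_sum (K : finType) (a b : K -> R) :
  (\sum_k a k * b k) ^+ 2 <= (\sum_k a k ^+ 2) * (\sum_k b k ^+ 2).
Proof.
have : 0 <= \sum_k \sum_l (a k * b l - a l * b k) ^+ 2.
  by apply: sumr_ge0 => k _; apply: sumr_ge0 => l _; exact: sqr_ge0.
suff -> : \sum_k \sum_l (a k * b l - a l * b k) ^+ 2 =
    2 * ((\sum_k a k ^+ 2) * (\sum_k b k ^+ 2) - (\sum_k a k * b k) ^+ 2).
  by rewrite pmulr_rge0// subr_ge0.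
transitivity (\sum_k \sum_l (a k ^+ 2 * b l ^+ 2) +
    \sum_k \sum_l (b k ^+ 2 * a l ^+ 2) -
    2 * \sum_k \sum_l (a k * b k * (a l * b l))).
  rewrite mulr_sumr -big_split/= -sumrB; apply: eq_bigr => k _.
  rewrite mulr_sumr -big_split/= -sumrB; apply: eq_bigr => l _; ring.
by rewrite -!big_distrlr/= -expr2; ring.
Qed.

Lemma sqnorm_mulmx n (M : 'M[R]_n) (v : 'cV[R]_n) :
  sqnorm (M *m v) <= frobenius M * sqnorm v.
Proof.
rewrite mulr_suml; apply: ler_sum => k _; rewrite mxE.
exact: (cauchy_schwarz_sum (fun l => M k l) (fun l => v l 0)).
Qed.

(** An index whose indicator is zero has [b k < y k ^+ 2 / (t * s)], and the sum of all these
    quotients is at most [F / t]. This is the deterministic inequality to which Markov's argument is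
    applied. *)
Lemma ler_sum_small (K : finType) (b y : K -> R) (s t F : R) : 0 < s -> 0 < t ->
  (forall k, 0 <= b k) -> \sum_k y k ^+ 2 <= s * F ->
  \sum_k b k <= \sum_k b k * (y k ^+ 2 <= t * s * b k)%R%:R + F / t.
Proof.
move=> s0 t0 b0 yF; have ts0 : 0 < t * s by rewrite mulr_gt0.
have {}yF : (\sum_k y k ^+ 2) / (t * s) <= F / t.
  rewrite ler_pdivrMr// (le_trans yF)// le_eqVlt; apply/orP; left; apply/eqP.
  by field; rewrite gt_eqF.
rewrite (le_trans _ (lerD (lexx _) yF))// mulr_suml -big_split/=.
apply: ler_sum => k _; have [_|h] := leP (y k ^+ 2) _.
  by rewrite mulr1 lerDl divr_ge0 ?sqr_ge0// ltW.
by rewrite mulr0 add0r ler_pdivlMr// mulrC ltW.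
Qed.

Lemma log_enormE n (v : 'cV[R]_n) : 0 < sqnorm v ->
  log_enorm v = (2^-1 * ln (sqnorm v))%:E.
Proof.
move=> v0; rewrite /log_enorm lne_EFin ?sqrtr_gt0// enormE.
by rewrite -powR12_sqrt ?ltW// ln_powR.
Qed.

Lemma log_enorm_le n (v : 'cV[R]_n) (a : R) : 0 < a -> sqnorm v <= a ->
  (log_enorm v <= (2^-1 * ln a)%:E)%E.
Proof.
move=> a0 va; have [v0|v0] := ltP 0 (sqnorm v).
  by rewrite log_enormE// lee_fin ler_pM2l// ler_ln// posrE.
rewrite /log_enorm le0_lneNy ?leNye// lee_fin enormE.
by rewrite ler0_sqrtr.
Qed.

(** The supremum is at least the value at [v], which fixes the sign inside the absolute value, and
    at most half the logarithm of [frobenius M]. *)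
Lemma log_enorm_gap n N (M : 'M[R]_n) (v : 'cV[R]_n) (eps : R) :
  (0 < n)%N -> (0 < N)%N -> 0 < eps -> sqnorm v = 1 ->
  (((2 * N%:R)^-1 * ln (n%:R / eps ^+ 2))%:E <=
     `| (N%:R^-1)%:E * log_enorm (M *m v) -
        (N%:R^-1)%:E *
          ereal_sup [set log_enorm (M *m u) | u in @unit_sphere R n] |)%E ->
  sqnorm (M *m v) <= n%:R^-1 * (eps ^+ 2 * frobenius M).
Proof.
move=> n0 N0 e0 v1; have n0' : 0 < n%:R :> R by rewrite ltr0n.
have N0' : 0 < N%:R :> R by rewrite ltr0n.
(* If [M *m v] is zero its logarithm is infinite, but the conclusion is trivial. *)
have [Mv0|] := ltP 0 (sqnorm (M *m v)); last first.
  by move=> h _; rewrite (le_trans h)// !mulr_ge0 ?invr_ge0 ?sqr_ge0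
    ?frobenius_ge0// ltW.
have MF u : sqnorm u = 1 -> sqnorm (M *m u) <= frobenius M.
  by move=> u1; have := sqnorm_mulmx M u; rewrite u1 mulr1.
have F0 : 0 < frobenius M by rewrite (lt_le_trans Mv0)// MF.
set S := ereal_sup _.
have S1 : (log_enorm (M *m v) <= S)%E.
  by apply: ereal_sup_ubound; exists v => //; apply/unit_sphereE.
have S2 : (S <= (2^-1 * ln (frobenius M))%:E)%E.
  apply: ge_ereal_sup => _ [u /unit_sphereE u1 <-].
  by apply: log_enorm_le => //; exact: MF.
rewrite log_enormE// in S1 *.
have Sfin : S \is a fin_num.
  by rewrite fin_numE; move: S1 S2; case: S.
move: S1 S2; rewrite -(fineK Sfin); set r := fine S; rewrite !lee_fin => S1 S2.
rewrite -mulrBr normrM distrC [`|N%:R^-1|]ger0_norm ?invr_ge0 ?(ltW N0')//.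
rewrite ger0_norm ?subr_ge0// invfM mulrAC [_ * N%:R^-1]mulrC -mulrA ler_pM2l
  ?invr_gt0//.
set q := sqnorm _ in Mv0 S1 * => h.
have {}h : ln (n%:R / eps ^+ 2) + ln q <= ln (frobenius M) by lra.
have ne0 : 0 < n%:R / eps ^+ 2 by rewrite divr_gt0// exprn_gt0.
move: h; rewrite -lnM ?posrE// ler_ln ?posrE// ?mulr_gt0 ?invr_gt0 ?exprn_gt0//
  => h.
rewrite mulrAC ler_pdivrMr ?exprn_gt0// in h.
by rewrite (ler_pdivlMl _ _ n0') (le_trans h)// le_eqVlt; apply/orP; left;
  apply/eqP; ring.
Qed.
End euclidean_norm.

(** * Measurability of the supremum over the sphere *)

Section operator_norm_measurability.
Context {R : realType}.

Lemma cvg_sumr (K : Type) (r : seq K) (u : K -> R^nat) (l : K -> R) :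
  (forall k, u k @ \oo --> l k) ->
  (fun i => \sum_(k <- r) u k i) @ \oo --> \sum_(k <- r) l k.
Proof. by move=> ul; apply: cvg_big => //; exact: add_continuous. Qed.

Lemma cvg_floor_div (x : R) :
  (fun k => k.+1%:R^-1 * (Num.floor (k.+1%:R * x))%:~R : R) @ \oo --> x.
Proof.
apply: (@squeeze_cvgr _ _ _ _ (fun k => x - k.+1%:R^-1) (fun=> x)).
- apply: nearW => k; have k0 : 0 < k.+1%:R :> R by rewrite ltr0n.
  rewrite ler_pdivlMl// mulrBr divff ?gt_eqF// ler_pdivrMl// floor_le_tmp.
  rewrite andbT; have := lt_succ_floor (k.+1%:R * x).
  by rewrite intrD lerBlDr => /ltW.
- rewrite -[X in _ --> X]subr0; apply: cvgB; first exact: cvg_cst.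
  exact: cvg_harmonic.
- exact: cvg_cst.
Qed.

(* Scaling reduces a supremum over the sphere to a countable one. *)
Lemma unit_vector_int_vector n (M : 'M[R]_n) (a : R) :
  (exists2 v, sqnorm v = 1 & a < sqnorm (M *m v)) <->
  (exists z : 'cV[int]_n, a * sqnorm (map_mx intr z : 'cV[R]_n) <
    sqnorm (M *m map_mx intr z)).
Proof.
split=> [[v v1 av]|[z az]].
  (* Rounding [k.+1 * v] down and rescaling gives vectors tending to [v]. The strict inequality
     passes to one of them by continuity, and to its integer multiple by homogeneity. *)
  pose z k : 'cV[int]_n := map_mx Num.floor (k.+1%:R *: v).
  pose u k : 'cV[R]_n := k.+1%:R^-1 *: map_mx intr (z k).
  have uv i : (fun k => u k i 0) @ \oo --> v i 0.
    rewrite (_ : (fun _ => _) =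
      (fun k => k.+1%:R^-1 * (Num.floor (k.+1%:R * v i 0))%:~R)).
      exact: cvg_floor_div.
    by apply/funext => k; rewrite !mxE.
  have cvgu : (fun k => sqnorm (u k)) @ \oo --> sqnorm v.
    by apply: cvg_sumr => i; apply: cvgM.
  have cvgMu : (fun k => sqnorm (M *m u k)) @ \oo --> sqnorm (M *m v).
    apply: cvg_sumr => i; rewrite mxE; under eq_fun do rewrite mxE.
    by apply: cvgM; apply: cvg_sumr => j; apply: cvgM => //; exact: cvg_cst.
  have : (fun k => sqnorm (M *m u k) - a * sqnorm (u k)) @ \oo -->
      sqnorm (M *m v) - a * sqnorm v.
    by apply: cvgB => //; apply: cvgM => //; exact: cvg_cst.
  move=> /cvgr_gt /(_ 0); rewrite v1 mulr1 subr_gt0 => /(_ av).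
  move=> [k _ /(_ k (leqnn k))] /=.
  rewrite /u -scalemxAr !sqnormZ mulrCA -mulrBr pmulr_rgt0.
    by rewrite subr_gt0; exists (z k).
  by rewrite exprn_gt0// invr_gt0 ltr0n.
(* The strict inequality fails for a zero vector, so [z] can be normalised. *)
have z0 : 0 < sqnorm (map_mx intr z : 'cV[R]_n).
  rewrite lt_neqAle sqnorm_ge0 andbT eq_sym; apply: contraTneq az => zE.
  by have := sqnorm_mulmx M (map_mx intr z); rewrite -leNgt zE !mulr0.
exists ((Num.sqrt (sqnorm (map_mx intr z : 'cV[R]_n)))^-1 *: map_mx intr z).
  by rewrite sqnormZ exprVn sqr_sqrtr ?ltW// mulVf// gt_eqF.
rewrite -scalemxAr sqnormZ exprVn sqr_sqrtr ?(ltW z0)//.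
by rewrite ltr_pdivlMl// mulrC.
Qed.

Lemma measurable_lne_EFin : measurable_fun [set: R] (fun x : R => lne x%:E).
Proof.
rewrite /lne; apply: measurable_fun_ifT => //.
  exact: measurable_fun_ler.
by apply/measurable_EFinP; exact: measurable_ln.
Qed.

Context d (T : measurableType d) (n : nat) (M : T -> 'M[R]_n).
Hypothesis mM : forall k l, measurable_fun setT (fun w => M w k l).

Lemma measurable_sqnorm_mulmx (v : 'cV[R]_n) :
  measurable_fun setT (fun w => sqnorm (M w *m v)).
Proof.
apply: measurable_sum => k; apply: measurable_funX.
under eq_fun do rewrite mxE.
by apply: measurable_sum => l; apply: measurable_funM.
Qed.

Lemma measurable_frobenius : measurable_fun setT (fun w => frobenius (M w)).
Proof.
apply: measurable_sum => k; apply: measurable_sum => l.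
exact: measurable_funX.
Qed.

Lemma measurable_sqnorm_le_frobenius (v : 'cV[R]_n) (a b : R) :
  measurable [set w | sqnorm (M w *m v) <= a * (b * frobenius (M w))].
Proof.
rewrite -[X in measurable X]setTI; apply: (measurable_fun_ler
  (f := fun w => sqnorm (M w *m v))
  (g := fun w => a * (b * frobenius (M w)))) => //.
  exact: measurable_sqnorm_mulmx.
apply: measurable_funM => //; apply: measurable_funM => //.
exact: measurable_frobenius.
Qed.

Lemma measurable_log_enorm (v : 'cV[R]_n) :
  measurable_fun setT (fun w => log_enorm (M w *m v)).
Proof.
apply: (@measurableT_comp _ _ _ _ _ _ (fun x : R => lne x%:E) _
  (fun w => enorm (M w *m v))); first exact: measurable_lne_EFin.
rewrite /enorm; apply: measurableT_comp; first exact: measurable_sqrt.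
exact: measurable_sqnorm_mulmx.
Qed.

(** Each set where the supremum exceeds [y] is a countable union, over integer vectors, of
    measurable sets. *)
Lemma measurable_sup_log_enorm :
  measurable_fun setT (fun w =>
    ereal_sup [set log_enorm (M w *m v) | v in @unit_sphere R n]).
Proof.
apply: (measurability _ (ErealGenOInfty.measurableE R)) => _ [_ [y ->] <-].
rewrite setTI [X in measurable X](_ : _ = \bigcup_(z : 'cV[int]_n)
  [set w | expR y ^+ 2 * sqnorm (map_mx intr z : 'cV[R]_n) <
    sqnorm (M w *m map_mx intr z)]).
  apply: countable_bigcupT_measurable; first exact: countableP.
  move=> z; rewrite -[X in measurable X]setTI.
  apply: (measurable_fun_ltr (f := cst _)
    (g := fun w => sqnorm (M w *m map_mx intr z))) => //.
  exact: measurable_sqnorm_mulmx.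
have E (v : 'cV[R]_n) : (y%:E < log_enorm v)%E = (expR y ^+ 2 < sqnorm v).
  have [v0|v0] := ltP 0 (sqnorm v).
    rewrite log_enormE// lte_fin ltr_pdivlMl// -expRM_natl -[in RHS](lnK v0).
    by rewrite ltr_expR.
  have -> : sqnorm v = 0 by apply/eqP; rewrite eq_le v0 sqnorm_ge0.
  rewrite /log_enorm enormE ler0_sqrtr// le0_lneNy// ltNge leNye/=.
  by rewrite ltNge sqr_ge0.
apply/seteqP; split => [w /=|w [z _ /= h]].
  rewrite in_itv/= andbT => /ereal_sup_gt[_ [v /unit_sphereE v1 <-]];
    rewrite E => yv.
  have [|z zE] := (unit_vector_int_vector (M w) (expR y ^+ 2)).1;
    first by exists v.
  by exists z.
rewrite in_itv/= andbT.
have [|v v1] := (unit_vector_int_vector (M w) (expR y ^+ 2)).2;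
  first by exists z.
rewrite -E => /lt_le_trans; apply; apply: ereal_sup_ubound.
by exists v => //; apply/unit_sphereE.
Qed.

End operator_norm_measurability.

(** * Random matrix products *)

Lemma ge0_integral_EFin_sum d (T : measurableType d) (R : realType)
    (mu : {measure set T -> \bar R}) (K : Type) (r : seq K) (f : K -> T -> R) :
  (forall k, measurable_fun setT (f k)) -> (forall k w, 0 <= f k w) ->
  (\int[mu]_w (\sum_(k <- r) f k w)%:E = \sum_(k <- r) \int[mu]_w (f k w)%:E)%E.
Proof.
move=> mf f0; under eq_integral do rewrite -sumEFin.
rewrite ge0_integral_sum// => k; first exact/measurable_EFinP.
by move=> w _; rewrite lee_fin.
Qed.

Section random_matrix_product.
Context d (T : measurableType d) (R : realType) (P : probability T R).
Context (n N m : nat).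
(** Length [N.+1] guarantees a rightmost factor in each chain and leaves [N] others. *)
Variable X : 'I_m -> 'I_N.+1 -> 'I_n -> 'I_n -> {RV P >-> R}.
Hypotheses (n0 : (0 < n)%N) (m0 : (0 < m)%N).
Hypothesis iidX : iid_gaussian_matrices X.

Let I : finType := ('I_m * 'I_N.+1 * 'I_n * 'I_n)%type.
Let Xp (p : I) := X p.1.1.1 p.1.1.2 p.1.2 p.2.
Let s : R := Num.sqrt n%:R^-1.

Let s0 : s != 0.
Proof. by rewrite gt_eqF// sqrtr_gt0 invr_gt0 ltr0n. Qed.

Let sE : s ^+ 2 = n%:R^-1.
Proof. by rewrite sqr_sqrtr// invr_ge0. Qed.

Let indX : mutually_independent Xp. Proof. by have [] := iidX. Qed.

Let lawX p A : measurable A -> distribution P (Xp p) A = normal_prob 0 s A.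
Proof. by have [_ h] := iidX; exact: h. Qed.

(** * Adapted matrices and nonvanishing of their products *)

Definition adapted_mx (J : {set I}) (M : T -> 'M[R]_n) :=
  forall k l, adapted Xp J (fun w => M w k l).

Lemma adapted_random_mx (J : {set I}) i j : (forall k l, (i, j, k, l) \in J) ->
  adapted_mx J (random_mx (X i j)).
Proof.
move=> hJ k l; rewrite /random_mx; under eq_fun do rewrite mxE.
exact: (@adapted_self _ _ _ _ _ Xp J (i, j, k, l)).
Qed.

Lemma adapted_mulmx (J : {set I}) (M M' : T -> 'M[R]_n) : adapted_mx J M ->
  adapted_mx J M' -> adapted_mx J (fun w => M w *m M' w).
Proof.
move=> mM mM' k l; under eq_fun do rewrite mxE.
by apply: measurable_sum => r; apply: measurable_funM; [exact: mM|exact: mM'].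
Qed.

Lemma adapted_prod (J : {set I}) q (Y : nat -> T -> 'M[R]_n) :
  (forall j, (j < q)%N -> adapted_mx J (Y j)) ->
  adapted_mx J (fun w => \prod_(j < q) Y j w).
Proof.
elim: q => [|q ih] mY.
  by move=> k l; under eq_fun do rewrite big_ord0; exact: measurable_cst.
rewrite (_ : (fun _ => _) = (fun w => (\prod_(j < q) Y j w) *m Y q w));
  last first.
  by apply/funext => w; rewrite big_ord_recr.
apply: adapted_mulmx; last exact: mY.
by apply: ih => j jq; apply: mY; rewrite ltnS ltnW.
Qed.

(** A nonzero [M w] has a nonzero row, whose product with the first column of the independent factor
    is a linear form of positive variance, hence almost surely nonzero. *)
Lemma mulmx_random_mx_neq0 (J : {set I}) i j (M : T -> 'M[R]_n) :
  (forall k l, (i, j, k, l) \notin J) -> adapted_mx J M ->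
  P.-negligible [set w | M w = 0] ->
  P.-negligible [set w | M w *m random_mx (X i j) w = 0].
Proof.
move=> hJ mM M0; pose l0 := Ordinal n0.
pose h (r : 'I_n) : I := (i, j, r, l0).
have h_inj : injective h by move=> r r' [].
(* Countable subadditivity takes a sequence, so the exceptional sets of the rows are indexed by
   [nat]; they are empty from [n] on. *)
pose F (q : nat) := [set w | exists2 k : 'I_n, k = q :> nat &
  \sum_r M w k r ^+ 2 != 0 /\ \sum_r M w k r * Xp (h r) w = 0].
have F0 q : P.-negligible (F q).
  have [qn|qn] := ltnP q n.
    apply: negligibleS (linear_form_neq0 s0 indX lawX
      (c := fun r w => M w (Ordinal qn) r)
      h_inj (fun r => hJ r l0) (mM (Ordinal qn))).
    move=> w [k kq].
    by have -> : k = Ordinal qn by exact/val_inj.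
  apply: negligibleS (negligible_set0 P) => w [k kq].
  by move: qn; rewrite -kq leqNgt ltn_ord.
apply: negligibleS (negligibleU M0 (negligible_bigcup F0)) => w /= Mw0.
have [M00|] := eqVneq (M w) 0; [by left|move=> Mn0; right].
have [k kn0] : exists k, \sum_r M w k r ^+ 2 != 0.
  apply: contrapT => /forallNP h0; move/eqP: Mn0; apply.
  apply/matrixP => k r; rewrite mxE; apply/eqP.
  have := h0 k; move/negP; rewrite negbK psumr_eq0; last by move=> ? _;
    exact: sqr_ge0.
  by move=> /allP /(_ r (mem_index_enum r)); rewrite /= sqrf_eq0.
exists k => //=; exists k => //; split=> //.
move/matrixP: Mw0 => /(_ k l0); rewrite mxE [RHS]mxE => E; rewrite -[RHS]E.
by apply: eq_bigr => r _; rewrite mxE.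
Qed.

(** The product of the [q] leftmost factors of the chain [i]; for [q = N] it is the matrix [A_i].
    Using [inord] lets [q] vary in inductions. *)
Definition tail_mx i q (w : T) : 'M[R]_n :=
  \prod_(j < q) random_mx (X i (rev_ord (inord j))) w.

(* The indices of the entries of the [q] leftmost factors of each chain. *)
Definition last_factors q : {set I} := [set p : I | (N < p.1.1.2 + q)%N].

Lemma adapted_tail_mx i q : (q <= N)%N ->
  adapted_mx (last_factors q) (tail_mx i q).
Proof.
move=> qN; apply: (adapted_prod
  (Y := fun j w => random_mx (X i (rev_ord (inord j))) w)) => j jq.
(* The factor at position [j] has index [N - j], and [N < (N - j) + q] since [j < q]. *)
apply: adapted_random_mx => k l; rewrite inE/= inordK; last first.
  by lia.
by lia.
Qed.

(** By induction from the identity matrix, nonzero since [n] is positive: the next factor has index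
    [N - q], just outside [last_factors q]. *)
Lemma tail_mx_neq0 i q : (q <= N)%N ->
  P.-negligible [set w | tail_mx i q w = 0].
Proof.
elim: q => [_|q ih qN].
  apply: negligibleS (negligible_set0 P) => w /=; rewrite /tail_mx big_ord0.
  move=> /matrixP /(_ (Ordinal n0) (Ordinal n0)); rewrite !mxE eqxx => /eqP.
  by rewrite oner_eq0.
have ltqN := ltnW qN.
apply: negligibleS (@mulmx_random_mx_neq0 (last_factors q) i
    (rev_ord (inord q)) (tail_mx i q) _ (adapted_tail_mx i ltqN) (ih ltqN)).
  by move=> w; rewrite /= /tail_mx big_ord_recr.
move=> k l; rewrite inE/= inordK; last by rewrite ltnS.
by rewrite subSS subnK// ltnn.
Qed.

Lemma chain_mxE i w :
  chain_mx (X i) w = tail_mx i N w *m random_mx (X i ord0) w.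
Proof.
rewrite /chain_mx big_ord_recr/= /tail_mx; congr (_ *m random_mx (X i _) w).
  apply: eq_bigr => j _; congr (random_mx (X i (rev_ord _)) w).
  by apply: val_inj; rewrite /= inordK// ltnS ltnW.
by apply: val_inj; rewrite /= subSS subnn.
Qed.

(** * Rows of the sum as linear forms in the rightmost factors *)

Let K : finType := ('I_m * 'I_n * 'I_n)%type.
(** The rightmost factors have index [ord0], the only one that [last_factors N] leaves out. *)
Let h (p : K) : I := (p.1.1, ord0, p.1.2, p.2).

Let h_inj : injective h.
Proof. by move=> [[i r] l] [[i' r'] l'] [-> -> ->]. Qed.

Let h_last p : h p \notin last_factors N.
Proof. by rewrite inE/= ltnn. Qed.

(** The coefficient of the variable [h p] in the [k]-th entry of [sum_mx X w *m v]. *)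
Definition row_coef (v : 'cV[R]_n) k (p : K) (w : T) : R :=
  (Num.sqrt m%:R)^-1 * tail_mx p.1.1 N w k p.1.2 * v p.2 0.

(** This is [b_k]: for a unit vector [v], it is [n] times the conditional variance of the [k]-th
    entry. *)
Definition row_energy k (w : T) : R :=
  m%:R^-1 * \sum_i \sum_r tail_mx i N w k r ^+ 2.

Lemma adapted_row_coef v k p :
  adapted Xp (last_factors N) (row_coef v k p).
Proof.
apply: measurable_funM => //; apply: measurable_funM => //.
exact: adapted_tail_mx.
Qed.

Lemma sum_mx_row v k w : (sum_mx X w *m v) k 0 =
  \sum_p row_coef v k p w * Xp (h p) w.
Proof.
rewrite /sum_mx -scalemxAl mxE mulmx_suml summxE mulr_sumr.
rewrite -(pair_bigA _ (fun a l => row_coef v k (a, l) w * Xp (h (a, l)) w))/=.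
rewrite -(pair_bigA _ (fun i r =>
  \sum_l row_coef v k ((i, r), l) w * Xp (h ((i, r), l)) w))/=.
apply: eq_bigr => i _; rewrite chain_mxE -mulmxA mxE mulr_sumr.
apply: eq_bigr => r _; rewrite mxE !mulr_sumr.
apply: eq_bigr => l _; rewrite mxE /row_coef /Xp/=; ring.
Qed.

(** The squared coefficients factor into a part depending on chain and row and a part depending on
    [v], so the direction of [v] is lost. *)
Lemma row_coef_energy v k w :
  \sum_p row_coef v k p w ^+ 2 = row_energy k w * sqnorm v.
Proof.
rewrite -(pair_bigA _ (fun a l => row_coef v k (a, l) w ^+ 2))/=.
rewrite -(pair_bigA _ (fun i r => \sum_l row_coef v k ((i, r), l) w ^+ 2))/=.
rewrite /row_energy -mulrA mulr_suml mulr_sumr; apply: eq_bigr => i _.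
rewrite mulr_suml mulr_sumr; apply: eq_bigr => r _.
rewrite !mulr_sumr; apply: eq_bigr => l _.
rewrite /row_coef/= !exprMn exprVn sqr_sqrtr ?ler0n//; ring.
Qed.

Lemma row_energy_ge0 k w : 0 <= row_energy k w.
Proof.
rewrite mulr_ge0 ?invr_ge0//; apply: sumr_ge0 => i _.
by apply: sumr_ge0 => r _; exact: sqr_ge0.
Qed.

Lemma adapted_row_energy k : adapted Xp (last_factors N) (row_energy k).
Proof.
apply: measurable_funM => //; apply: measurable_sum => i.
apply: measurable_sum => r; apply: measurable_funX; exact: adapted_tail_mx.
Qed.

Definition energy (w : T) : R := \sum_k row_energy k w.

(** A zero energy forces every entry of every [tail_mx i N w] to vanish; the chain of index 0
    already excludes this almost surely. *)
Lemma energy_neq0 : P.-negligible [set w | energy w = 0].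
Proof.
apply: negligibleS (tail_mx_neq0 (Ordinal m0) (leqnn N)) => w /= /eqP.
rewrite psumr_eq0; last by move=> k _; exact: row_energy_ge0.
move=> /allP E; apply/matrixP => k r; rewrite [RHS]mxE; apply/eqP.
have := E k (mem_index_enum k); rewrite /= mulf_eq0 invr_eq0 pnatr_eq0.
rewrite gtn_eqF//= psumr_eq0; last first.
  by move=> i _; apply: sumr_ge0 => r' _; exact: sqr_ge0.
move=> /allP /(_ (Ordinal m0) (mem_index_enum _)) /=.
rewrite psumr_eq0; last by move=> r' _; exact: sqr_ge0.
by move=> /allP /(_ r (mem_index_enum _)) /=; rewrite sqrf_eq0.
Qed.

(** This is [w_k]. Where the energy is zero its inverse is zero too, so all weights vanish and their
    sum is at most 1 everywhere. *)
Definition row_weight k (w : T) : R := (energy w)^-1 * row_energy k w.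

Lemma energy_ge0 w : 0 <= energy w.
Proof. by apply: sumr_ge0 => k _; exact: row_energy_ge0. Qed.

Lemma adapted_energyV : adapted Xp (last_factors N) (fun w => (energy w)^-1).
Proof.
(* On nonnegative reals the inverse is the power of exponent [-1], which is measurable also across
   zero. *)
under eq_fun do rewrite -powR_inv1 ?energy_ge0//.
apply: (@measurableT_comp _ _ _ _ _ _ (@powR R ^~ (-1))).
  exact: measurable_powR.
by apply: measurable_sum => k; exact: adapted_row_energy.
Qed.

Lemma row_weight_ge0 k w : 0 <= row_weight k w.
Proof. by rewrite mulr_ge0 ?invr_ge0 ?energy_ge0 ?row_energy_ge0. Qed.

Lemma adapted_row_weight k : adapted Xp (last_factors N) (row_weight k).
Proof.
by apply: measurable_funM; [exact: adapted_energyV|exact: adapted_row_energy].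
Qed.

Lemma measurable_row_weight k : measurable_fun setT (row_weight k).
Proof. exact: adapted_measurable (adapted_row_weight k). Qed.

Lemma integral_row_weight_le1 : (\sum_k \int[P]_w (row_weight k w)%:E <= 1)%E.
Proof.
rewrite -ge0_integral_EFin_sum; last 2 first.
- exact: measurable_row_weight.
- exact: row_weight_ge0.
rewrite -[leRHS]mul1e -[X in (_ * X)%E](probability_setT P) -integral_cst//.
apply: ge0_le_integral => //.
- by move=> w _; rewrite lee_fin sumr_ge0// => k _; exact: row_weight_ge0.
- by apply/measurable_EFinP; apply: measurable_sum => k;
    exact: measurable_row_weight.
move=> w _; rewrite lee_fin -mulr_sumr -/(energy w).
by have [->|e0] := eqVneq (energy w) 0; rewrite ?mulr0// mulVf.
Qed.

(** * Measurability and expectation bounds for the sum *)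

Lemma sum_mx_entry k l w :
  sum_mx X w k l = (sum_mx X w *m (delta_mx l 0 : 'cV[R]_n)) k 0.
Proof. by rewrite -colE [RHS]mxE. Qed.

Lemma measurable_sum_mx k l : measurable_fun setT (fun w => sum_mx X w k l).
Proof.
under eq_fun do rewrite sum_mx_entry sum_mx_row.
apply: measurable_sum => p; apply: measurable_funM => //.
exact: adapted_measurable (adapted_row_coef _ _ _).
Qed.

Lemma measurable_sum_mx_mul (v : 'cV[R]_n) k :
  measurable_fun setT (fun w => (sum_mx X w *m v) k 0).
Proof.
under eq_fun do rewrite mxE; apply: measurable_sum => l.
by apply: measurable_funM => //; exact: measurable_sum_mx.
Qed.

Lemma sqnorm_delta (l : 'I_n) : sqnorm (delta_mx l 0 : 'cV[R]_n) = 1.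
Proof.
rewrite /sqnorm (bigD1 l)//= big1 ?addr0 => [|k kl]; rewrite mxE.
  by rewrite !eqxx expr1n.
by rewrite (negbTE kl)/= expr0n.
Qed.

(** By linearity the rows are treated one at a time, with small-ball radius [t = Num.sqrt eps]; the
    weights have total expectation at most 1. *)
Lemma integral_small_rows (v : 'cV[R]_n) (eps : R) : sqnorm v = 1 -> 0 < eps ->
  (\int[P]_w (\sum_k row_weight k w *
     ((sum_mx X w *m v) k 0 ^+ 2 <= eps * n%:R^-1 * row_energy k w)%R%:R)%:E
   <= (Num.sqrt eps)%:E)%E.
Proof.
move=> v1 eps0; rewrite ge0_integral_EFin_sum; last 2 first.
- move=> k; apply: measurable_funM; first exact: measurable_row_weight.
  apply: measurable_bool_natr; apply: measurable_fun_ler.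
    by apply: measurable_funX; exact: measurable_sum_mx_mul.
  by apply: measurable_funM => //;
    exact: adapted_measurable (adapted_row_energy k).
- by move=> k w; rewrite mulr_ge0// row_weight_ge0.
apply: (@le_trans _ _
  (\sum_k ((Num.sqrt eps)%:E * \int[P]_w (row_weight k w)%:E))%E).
  apply: lee_sum => k _.
  rewrite -ge0_integralZl//; last 2 first.
  - by apply/measurable_EFinP; exact: measurable_row_weight.
  - by move=> w _; rewrite lee_fin row_weight_ge0.
  have VW w : \sum_p row_coef v k p w ^+ 2 = 0 -> row_weight k w = 0.
    by rewrite row_coef_energy v1 mulr1 /row_weight => ->; rewrite mulr0.
  apply: le_trans (linear_form_small_ball s0 indX lawX h_inj h_last
    (adapted_row_coef v k) (adapted_row_weight k) (row_weight_ge0 k)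
    (sqrtr_ge0 eps) VW).
  rewrite le_eqVlt; apply/orP; left; apply/eqP; apply: eq_integral => w _.
  by rewrite -sum_mx_row row_coef_energy v1 mulr1 sE (sqr_sqrtr (ltW eps0)).
rewrite -ge0_sume_distrr; last first.
  by move=> k _; apply: integral_ge0 => w _; rewrite lee_fin row_weight_ge0.
rewrite -[leRHS]mule1; apply: lee_wpmul2l; first by rewrite lee_fin sqrtr_ge0.
exact: integral_row_weight_le1.
Qed.

(** An entry is the linear form of a basis vector, with conditional second moment at most
    [8 * row_energy k / n]. Summing over the [n] columns cancels [n], and dividing by the energy
    leaves 8 times the weights. *)
Lemma integral_frobenius :
  (\int[P]_w ((energy w)^-1 * frobenius (sum_mx X w))%:E <= 8%:E)%E.
Proof.
have eV0 w : 0 <= (energy w)^-1 by rewrite invr_ge0 energy_ge0.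
have mf k l :
    measurable_fun setT (fun w => (energy w)^-1 * sum_mx X w k l ^+ 2).
  apply: measurable_funM; first exact: adapted_measurable adapted_energyV.
  by apply: measurable_funX; exact: measurable_sum_mx.
have f0 k l w : 0 <= (energy w)^-1 * sum_mx X w k l ^+ 2.
  by rewrite mulr_ge0// sqr_ge0.
under eq_integral.
  move=> w _; rewrite /frobenius mulr_sumr; under eq_bigr do rewrite mulr_sumr.
  over.
rewrite ge0_integral_EFin_sum; last 2 first.
- by move=> k; exact: measurable_sum.
- by move=> k w; exact: sumr_ge0.
under eq_bigr do rewrite ge0_integral_EFin_sum//.
apply: (@le_trans _ _ (\sum_k \sum_(l < n)
    ((8 * n%:R^-1)%:E * \int[P]_w (row_weight k w)%:E))%E).
  apply: lee_sum => k _; apply: lee_sum => l _.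
  rewrite -ge0_integralZl//; last 2 first.
  - by apply/measurable_EFinP; exact: measurable_row_weight.
  - by move=> w _; rewrite lee_fin row_weight_ge0.
  rewrite [leLHS](_ : _ = \int[P]_w ((energy w)^-1 *
      (\sum_p row_coef (delta_mx l 0) k p w * Xp (h p) w) ^+ 2)%:E)%E;
        last first.
    by apply: eq_integral => w _; rewrite -sum_mx_row -sum_mx_entry.
  apply: le_trans (linear_form_second_moment s0 indX lawX h_inj h_last
    (adapted_row_coef (delta_mx l 0) k) adapted_energyV eV0) _.
  rewrite le_eqVlt; apply/orP; left; apply/eqP; apply: eq_integral => w _.
  by rewrite row_coef_energy sqnorm_delta mulr1 sE.
under eq_bigr => k _.
  rewrite -ge0_sume_distrl// sumEFin sumr_const card_ord.
  rewrite -(mulr_natr (8 / n%:R)) divfK ?pnatr_eq0 -?lt0n//.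
  over.
rewrite -ge0_sume_distrr; last first.
  by move=> k _; apply: integral_ge0 => w _; rewrite lee_fin row_weight_ge0.
rewrite -[leRHS]mule1; apply: lee_wpmul2l => //.
exact: integral_row_weight_le1.
Qed.

(** Almost everywhere the indicator of the event is at most [g1 + eps * g2], whose integral is at
    most [Num.sqrt eps + 8 * eps]. *)
Lemma small_norm_prob (v : 'cV[R]_n) (eps : R) :
  sqnorm v = 1 -> 0 < eps -> eps < 1 ->
  (P [set w | (sqnorm (sum_mx X w *m v) <=
                n%:R^-1 * (eps ^+ 2 * frobenius (sum_mx X w)))%R]
   <= (9 * Num.sqrt eps)%:E)%E.
Proof.
move=> v1 e0 e1; set A := [set w | _].
have mM := measurable_sum_mx.
have mA : measurable A by exact: measurable_sqnorm_le_frobenius.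
pose g1 w := \sum_k row_weight k w *
     ((sum_mx X w *m v) k 0 ^+ 2 <= eps * n%:R^-1 * row_energy k w)%R%:R.
pose g2 w := (energy w)^-1 * frobenius (sum_mx X w).
have mg1 : measurable_fun setT g1.
  apply: measurable_sum => k; apply: measurable_funM;
    first exact: measurable_row_weight.
  apply: measurable_bool_natr; apply: measurable_fun_ler.
    by apply: measurable_funX; exact: measurable_sum_mx_mul.
  by apply: measurable_funM => //;
    exact: adapted_measurable (adapted_row_energy k).
have mg2 : measurable_fun setT g2.
  apply: measurable_funM; first exact: adapted_measurable adapted_energyV.
  exact: measurable_frobenius.
have g10 w : 0 <= g1 w.
  by apply: sumr_ge0 => k _; rewrite mulr_ge0// row_weight_ge0.
have g20 w : 0 <= g2 w by rewrite mulr_ge0 ?frobenius_ge0// invr_ge0 energy_ge0.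
apply: (@le_trans _ _ (\int[P]_w ((g1 w)%:E + eps%:E * (g2 w)%:E))%E).
  rewrite -[A]setIT -integral_indic//; apply: ae_ge0_le_integral => //.
  - by apply/measurable_EFinP; exact: measurable_indic.
  - by move=> w _; rewrite adde_ge0// ?mule_ge0// lee_fin// ltW.
  - apply: emeasurable_funD; first exact/measurable_EFinP.
    by apply: emeasurable_funM => //; exact/measurable_EFinP.
  apply: negligibleS energy_neq0 => w /=; apply: contra_notP => /eqP en0 _.
  rewrite -EFinM -EFinD lee_fin indicE; case: (boolP (w \in A)) => wA;
    last first.
    by rewrite addr_ge0// mulr_ge0// ltW.
  have n0' : 0 < n%:R^-1 :> R by rewrite invr_gt0 ltr0n.
  (* Taking [t = eps] and [F = eps ^+ 2 * frobenius] leaves a remainder with a single factor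
     [eps]. *)
  move: wA; rewrite inE /A/= => /(ler_sum_small n0' e0 (row_energy_ge0 ^~ w)).
  rewrite -/(energy w) => E; rewrite -(mulVf en0).
  have eV0 : 0 <= (energy w)^-1 by rewrite invr_ge0 energy_ge0.
  apply: (le_trans (ler_wpM2l eV0 E)).
  rewrite mulrDr mulr_sumr /g1 /g2; apply: lerD.
    by apply: ler_sum => k _; rewrite mulrA.
  rewrite le_eqVlt; apply/orP; left; apply/eqP; field.
  by rewrite en0 gt_eqF.
rewrite ge0_integralD//; last 4 first.
- by move=> w _; rewrite lee_fin.
- exact/measurable_EFinP.
- by move=> w _; rewrite mule_ge0// lee_fin// ltW.
- by apply: emeasurable_funM => //; exact/measurable_EFinP.
rewrite ge0_integralZl//; last 3 first.
- exact/measurable_EFinP.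
- by move=> w _; rewrite lee_fin.
- by rewrite lee_fin ltW.
apply: (@le_trans _ _ ((Num.sqrt eps)%:E + eps%:E * 8%:E)%E).
  apply: leeD; first exact: integral_small_rows.
  by apply: lee_wpmul2l; [rewrite lee_fin ltW|exact: integral_frobenius].
rewrite -EFinM -EFinD lee_fin.
have r0 := sqrtr_ge0 eps.
have r1 : Num.sqrt eps <= 1 by rewrite -[leRHS]sqrtr1 ler_wsqrtr// ltW.
(* Since [eps < 1], [eps] is at most its square root. *)
rewrite -[X in X * 8](sqr_sqrtr (ltW e0)); nra.
Qed.

End random_matrix_product.

(** * From the gap of logarithms to the small-norm event *)

Theorem lemma4 (R : realType) :
  exists2 C : R, 0 < C &
  forall (n N m : nat), (0 < n)%N -> (0 < N)%N -> (0 < m)%N ->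
  forall (d : measure_display) (T : measurableType d) (P : probability T R)
    (X : 'I_m -> 'I_N -> 'I_n -> 'I_n -> {RV P >-> R}),
  iid_gaussian_matrices X ->
  forall (eps : R), 0 < eps < 1 ->
  forall (theta : 'cV[R]_n), unit_sphere theta ->
  (P [set w |
        (((2 * N%:R)^-1 * ln (n%:R / eps ^+ 2))%:E <=
         `| (N%:R^-1)%:E * log_enorm (sum_mx X w *m theta) -
            (N%:R^-1)%:E *
              ereal_sup [set log_enorm (sum_mx X w *m theta') |
                         theta' in @unit_sphere R n] |)%E]
   <= ((C * eps) `^ (2^-1))%:E)%E.
Proof.
(* The constant is [9 ^+ 2], so that the right-hand side is [9 * Num.sqrt eps]. *)
exists 81 => // n [//|N] m n0 _ m0 d T P X iidX eps /andP[e0 e1] theta.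
move=> /unit_sphereE th1; set A := [set w | _].
have mM := measurable_sum_mx X n0 m0.
have mA : measurable A.
  rewrite -[X in measurable X]setTI; apply: emeasurable_fun_c_infty => //.
  apply: measurableT_comp => //; apply: emeasurable_funB.
    by apply: emeasurable_funM => //; exact: measurable_log_enorm.
  by apply: emeasurable_funM => //; exact: measurable_sup_log_enorm.
rewrite powR12_sqrt ?mulr_ge0 ?(ltW e0)// sqrtrM// [X in X * _](_ : _ = 9);
  last first.
  by rewrite (_ : 81 = 9 ^+ 2) ?sqrtr_sqr ?ger0_norm// -natrX.
apply: (le_trans _ (small_norm_prob n0 m0 iidX th1 e0 e1)).
apply: le_measure; rewrite ?inE//; first exact: measurable_sqnorm_le_frobenius.
by move=> w; exact: log_enorm_gap.
Qed.
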